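(* Let $n\geq 1$. Let $a_1(n)$ be the number of partitions $\lambda$ of $n$ satisfying the following: - the set of even parts of $\lambda$ has exactly one element, $2^k m$, with $k\ge 1$ and $m$ odd; - the part $2^k m$ occurs in $\lambda$ with odd multiplicity; - $m$ is a part of $\lambda$ whose multiplicity lies between $1$ and $2^k-1$ inclusive. Let $b_1(n)$ be the total number of parts in all partitions of $n$ into distinct parts minus the total number of different parts in all partitions of $n$ into odd parts, where in each partition into odd parts every distinct part value is counted once. Then $a_1(n)=b_1(n)$.
   Context: A partition of $n$ is a non-increasing sequence of positive integers (its parts) summing to $n$. *)

(* Defs.v *)
From HB Require Import structures.
From mathcomp Require Import all_boot all_order all_algebra.
Set Implicit Arguments.
Unset Strict Implicit.
Unset Printing Implicit Defensive.

Definition is_partition (n : nat) (s : seq nat) : bool :=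
  [&& sorted geq s, 0 \notin s & sumn s == n].

Record intpart (n : nat) : Type := IntPart {
  parts :> seq nat;
  partsP : is_partition n parts
}.

HB.instance Definition _ n := [isSub for @parts n].
HB.instance Definition _ n := [Countable of intpart n by <:].

Lemma leq_mem_sumn (s : seq nat) (x : nat) : x \in s -> x <= sumn s.
Proof.
elim: s => //= y s IHs; rewrite inE => /orP[/eqP-> | /IHs le_x].
  exact: leq_addr.
exact: leq_trans le_x (leq_addl _ _).
Qed.

Lemma size_leq_sumn (s : seq nat) : 0 \notin s -> size s <= sumn s.
Proof.
elim: s => //= y s IHs; rewrite inE negb_or => /andP[y_neq0 /IHs le_s].
by rewrite -add1n leq_add // lt0n eq_sym.
Qed.

Lemma mem_intpart_leq n (l : intpart n) (x : nat) : x \in parts l -> x <= n.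
Proof.
by have /and3P[_ _ /eqP sum_l] := partsP l; move=> /leq_mem_sumn; rewrite sum_l.
Qed.

Lemma size_intpart n (l : intpart n) : size [seq inord x : 'I_n.+1 | x <- l] <= n.
Proof.
have /and3P[_ l_neq0 /eqP sum_l] := partsP l.
by rewrite size_map -[leqRHS]sum_l size_leq_sumn.
Qed.

(* Finiteness: the parts and the number of parts of a partition of [n] are at
   most [n]. *)
Definition intpart_bseq n (l : intpart n) : n.-bseq 'I_n.+1 :=
  Bseq (size_intpart l).
Definition bseq_intpart n (s : n.-bseq 'I_n.+1) : option (intpart n) :=
  insub [seq val x | x <- s].

Lemma intpart_bseqK n : pcancel (@intpart_bseq n) (@bseq_intpart n).
Proof.
move=> l; rewrite /bseq_intpart /= -map_comp map_id_in ?valK //.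
by move=> x l_x /=; rewrite inordK // ltnS (mem_intpart_leq l_x).
Qed.

HB.instance Definition _ n : isFinite (intpart n) :=
  PCanIsFinite (@intpart_bseqK n).

Definition single_even_cond (s : seq nat) (k m : nat) : bool :=
  [&& 1 <= k,
      odd m,
      undup [seq x <- s | ~~ odd x] == [:: 2 ^ k * m],
      odd (count_mem (2 ^ k * m) s)
    & 1 <= count_mem m s <= 2 ^ k - 1].

(* Bounding [k] and [m] by [n] loses nothing, see [single_evenP]. *)
Definition single_even n (l : intpart n) : bool :=
  [exists k : 'I_n.+1, exists m : 'I_n.+1, single_even_cond l k m].

Lemma single_evenP n (l : intpart n) :
  reflect (exists k m : nat, single_even_cond l k m) (single_even l).
Proof.
apply: (iffP existsP) => [[k /existsP[m lkm]] | [k [m lkm]]].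
  by exists k, m.
have /and5P[_ odd_m /eqP even_l _ _] := lkm.
have l_e: 2 ^ k * m \in parts l.
  have: 2 ^ k * m \in undup [seq x <- parts l | ~~ odd x] by rewrite even_l inE.
  by rewrite mem_undup mem_filter => /andP[].
have le_n := mem_intpart_leq l_e.
have lt_k: k < n.+1.
  rewrite ltnS; apply: leq_trans le_n.
  apply: leq_trans (ltnW (ltn_expl k (ltnSn 1))) _.
  by rewrite leq_pmulr // odd_gt0.
have lt_m: m < n.+1.
  by rewrite ltnS; apply: leq_trans le_n; rewrite leq_pmull // expn_gt0.
by exists (Ordinal lt_k); apply/existsP; exists (Ordinal lt_m).
Qed.

Definition a1 (n : nat) : nat := #|[set l : intpart n | single_even l]|.

Definition b1 (n : nat) : int :=
  ((\sum_(l : intpart n | uniq l) size l)%N%:Z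
   - (\sum_(l : intpart n | all odd l) size (undup l))%N%:Z)%R.

(* Main.v *)
Require Import Defs.
From mathcomp Require Import all_boot all_order all_algebra.

(** Glaisher's map replaces each part [2 ^ k * m], [m] odd, by [2 ^ k] copies of
    [m]. On partitions into distinct parts it is a bijection onto partitions
    into odd parts, and [2 ^ k * m] is a part of the source exactly when the
    [k]-th binary digit of the multiplicity [M] of [m] in the image is 1. Hence
    [b1 n] counts the triples (partition into odd parts, [m], [k]) such that the
    [k]-th digit of [M] is 1 and is not the lowest such digit. The same map on
    the partitions counted by [a1 n], where [2 ^ k * m] is the even part, has as
    fibres the choices of [(k, m)] with [M %/ 2 ^ k] odd and
    [0 < M %% 2 ^ k], which is the same condition. *)

Set Implicit Arguments.
Unset Strict Implicit.
Unset Printing Implicit Defensive.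

(** The two maps need to be mutually inverse only on [P] and [Q], because the maps between
    partitions used below may take junk values elsewhere. *)
Lemma big_bij (R : Type) (idx : R) (op : Monoid.com_law idx) (I J : finType)
    (h : J -> I) (h' : I -> J) (P : pred I) (Q : pred J) (F : I -> R) :
  (forall i, P i -> Q (h' i) /\ h (h' i) = i) ->
  (forall j, Q j -> P (h j) /\ h' (h j) = j) ->
  \big[op/idx]_(i | P i) F i = \big[op/idx]_(j | Q j) F (h j).
Proof.
move=> PQ QP; rewrite (reindex_onto h h') => [|i /PQ[]//].
apply: eq_bigl => j; apply/andP/idP => [[/PQ[Qj _] /eqP hj]|/QP[-> ->]//].
by rewrite -hj.
Qed.

(** * Binary digits *)

Lemma logn2_pow2_mul k m : odd m -> logn 2 (2 ^ k * m) = k.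
Proof. by move=> m_odd; rewrite mulnC logn_Gauss ?coprime2n // pfactorK. Qed.

Lemma odd_mul_pow2_inj k k' m m' : odd m -> odd m' ->
  2 ^ k * m = 2 ^ k' * m' -> k = k' /\ m = m'.
Proof.
move=> m_odd m'_odd eq_e.
have eq_k: k = k' by rewrite -(logn2_pow2_mul k m_odd) eq_e logn2_pow2_mul.
by split=> //; move/eqP: eq_e; rewrite eq_k eqn_pmul2l ?expn_gt0 // => /eqP.
Qed.

Lemma odd_mul_pow2P x : 0 < x -> exists k m, odd m /\ x = 2 ^ k * m.
Proof.
move=> x_gt0; have [m m_odd ->] := pfactor_coprime (isT : prime 2) x_gt0.
by exists (logn 2 x), m; rewrite -coprime2n mulnC.
Qed.

Lemma binary_sum N M : M < 2 ^ N -> \sum_(k < N) 2 ^ k * odd (M %/ 2 ^ k) = M.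
Proof.
elim: N M => [|N IHN] M; first by rewrite ltnS leqn0 => /eqP->; rewrite big_ord0.
move=> lt_M; rewrite big_ord_recl /= expn0 mul1n divn1.
have lt_M2: M./2 < 2 ^ N by rewrite ltn_half_double -muln2 mulnC -expnS.
rewrite -[RHS]odd_double_half; congr (_ + _).
rewrite -[in RHS](IHN _ lt_M2) -muln2 big_distrl; apply: eq_bigr => k _ /=.
by rewrite /bump add1n expnS divnMA divn2 -mulnA mulnC.
Qed.

(** Uniqueness of the binary expansion: [b 0] is the parity of the sum, and halving shifts the
    remaining digits down by one place. *)
Lemma binary_digit N (b : nat -> bool) j : j < N ->
  odd ((\sum_(k < N) 2 ^ k * b k) %/ 2 ^ j) = b j.
Proof.
elim: N b j => // N IHN b j lt_j; rewrite big_ord_recl /= expn0 mul1n.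
have ->: \sum_(i < N) 2 ^ bump 0 i * b (bump 0 i)
       = (\sum_(i < N) 2 ^ i * b i.+1).*2.
  rewrite -muln2 big_distrl; apply: eq_bigr => k _ /=.
  by rewrite /bump add1n expnS -mulnA mulnC.
case: j lt_j => [|j] lt_j; first by rewrite divn1 oddD odd_double oddb addbF.
by rewrite expnS divnMA divn2 half_bit_double (IHN (fun k => b k.+1)).
Qed.

(** The one [k] counted is the 2-adic valuation of [M]: a zero remainder and an odd quotient write
    [M] as [2 ^ k] times an odd number, which is possible in one way only. *)
Lemma lowest_digit N M : M < 2 ^ N ->
  \sum_(k < N) (odd (M %/ 2 ^ k) && (M %% 2 ^ k == 0)) = (0 < M).
Proof.
case: (posnP M) => [-> _|M_gt0 lt_M].
  by rewrite big1 // => k _; rewrite div0n.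
have [j [m [m_odd def_M]]] := odd_mul_pow2P M_gt0.
have lt_j: j < N.
  rewrite -(@ltn_exp2l 2) //; apply: leq_ltn_trans lt_M.
  by rewrite def_M leq_pmulr ?odd_gt0.
rewrite (bigD1 (Ordinal lt_j)) //= big1 => [|k].
  by rewrite def_M mulKn ?expn_gt0 // modnMr m_odd.
apply: contraNeq; rewrite eqb0 negbK => /andP[odd_q /eqP mod0].
have eq_M := divn_eq M (2 ^ k); rewrite mod0 addn0 mulnC {1}def_M in eq_M.
by have [eq_k _] := odd_mul_pow2_inj m_odd odd_q eq_M; apply/eqP/val_inj.
Qed.

Lemma digits_split N M : M < 2 ^ N ->
  \sum_(k < N) odd (M %/ 2 ^ k)
  = \sum_(k < N) (odd (M %/ 2 ^ k) && (0 < M %% 2 ^ k)) + (0 < M).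
Proof.
move=> lt_M; rewrite -(lowest_digit lt_M) -big_split; apply: eq_bigr => k _ /=.
by case: odd; case: posnP.
Qed.

(** Every positive [x] is [2 ^ k * m] for exactly one [k] and one odd [m]. The hypotheses on [F]
    deal with 0, which has no such form, and with pairs whose product exceeds [n]. *)
Lemma dyadic_sum n (F : nat -> nat) :
  F 0 = 0 -> (forall x, n < x -> F x = 0) ->
  \sum_(x < n.+1) F x = \sum_(m < n.+1 | odd m) \sum_(k < n.+1) F (2 ^ k * m).
Proof.
move=> F0 Fn.
(* After inserting this indicator sum and exchanging summations, each [x] contributes [F x] times
   the number of pairs with [2 ^ k * m = x]. *)
have pick_x (y : nat) : F y = \sum_(x < n.+1) (y == x) * F x.
  have [lt_n|le_y] := ltnP n y; last first.
    rewrite (bigD1 (Ordinal (le_y : y < n.+1))) //= eqxx mul1n big1 ?addn0 // => x.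
    by rewrite -val_eqE eq_sym /= => /negPf->.
  by rewrite Fn ?big1 // => x _; case: eqP => // <-; rewrite Fn.
under [RHS]eq_bigr => m _ do
  (under eq_bigr => k _ do rewrite pick_x; rewrite exchange_big /=).
rewrite exchange_big /=; apply: eq_bigr => x _.
have [x0|x_gt0] := posnP x.
  by rewrite x0 F0 big1 // => m _; rewrite big1 // => k _; rewrite muln0.
have [j [p [p_odd def_x]]] := odd_mul_pow2P x_gt0.
have lt_p: p < n.+1.
  by apply: leq_ltn_trans (ltn_ord x); rewrite def_x leq_pmull ?expn_gt0.
have lt_j: j < n.+1.
  apply: ltn_trans (ltn_expl j (ltnSn 1)) (leq_ltn_trans _ (ltn_ord x)).
  by rewrite def_x leq_pmulr ?odd_gt0.
rewrite (bigD1 (Ordinal lt_p)) //= (bigD1 (Ordinal lt_j)) //= -def_x eqxx mul1n.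
rewrite !big1 ?addn0 // => [m /andP[m_odd ne_m]|k ne_k].
  rewrite big1 // => k _; case: eqP => //; rewrite def_x.
  case/(odd_mul_pow2_inj m_odd p_odd) => _ eq_m.
  by case/eqP: ne_m; apply: val_inj.
case: eqP => //; rewrite [in RHS]def_x => /(odd_mul_pow2_inj p_odd p_odd)[eq_k _].
by case/eqP: ne_k; apply: val_inj.
Qed.

(** * Partitions as multiplicity functions *)

Lemma sum_seq_count n (F : nat -> nat) (s : seq nat) :
  {in s, forall x, x <= n} ->
  \sum_(y <- s) F y = \sum_(x < n.+1) F x * count_mem (x : nat) s.
Proof.
elim: s => /= [|y s IHs] le_n.
  by rewrite big_nil big1 // => x _; rewrite muln0.
rewrite big_cons IHs => [|x s_x]; last by rewrite le_n // inE s_x orbT.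
under [RHS]eq_bigr do rewrite mulnDr.
rewrite big_split /=; congr (_ + _).
have lt_y: y < n.+1 by rewrite ltnS le_n ?mem_head.
rewrite (bigD1 (Ordinal lt_y)) //= eqxx muln1 big1 ?addn0 // => x.
by rewrite -val_eqE eq_sym /= => /negPf->; rewrite muln0.
Qed.

Lemma sumn_count n (s : seq nat) : {in s, forall x, x <= n} ->
  sumn s = \sum_(x < n.+1) x * count_mem (x : nat) s.
Proof. by rewrite sumnE; apply: sum_seq_count. Qed.

Lemma size_undup_sum n (s : seq nat) : {in s, forall x, x <= n} ->
  size (undup s) = \sum_(x < n.+1) ((x : nat) \in s).
Proof.
move=> le_n; rewrite -sum1_size (@sum_seq_count n) => [|x]; last first.
  by rewrite mem_undup => /le_n.
by apply: eq_bigr => x _; rewrite mul1n count_uniq_mem ?undup_uniq // mem_undup.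
Qed.

Section Multiplicities.
Variable n : nat.
Implicit Types l : intpart n.

Lemma sum_mult l : \sum_(x < n.+1) x * count_mem (x : nat) l = n.
Proof.
rewrite -(sumn_count (fun x => @mem_intpart_leq n l x)).
by have /and3P[_ _ /eqP] := partsP l.
Qed.

Lemma mul_mult_leq l x : x * count_mem x l <= n.
Proof.
have [lt_x|lt_x] := ltnP x n.+1.
  by rewrite -[leqRHS](sum_mult l) (bigD1 (Ordinal lt_x)) //= leq_addr.
rewrite (count_memPn _) ?muln0 //.
by apply: contraL lt_x => /mem_intpart_leq; rewrite -ltnNge.
Qed.

Lemma mult0 l : count_mem 0 l = 0.
Proof. by have /and3P[_ l0 _] := partsP l; apply/count_memPn. Qed.

Lemma mult_gt_n l x : n < x -> count_mem x l = 0.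
Proof.
move=> lt_x; apply/count_memPn; apply: contraL lt_x => /mem_intpart_leq.
by rewrite -leqNgt.
Qed.

(** This bound makes [n.+1] binary digits enough for the multiplicity of any positive part. *)
Lemma mult_lt l x : 0 < x -> count_mem x l < 2 ^ n.+1.
Proof.
move=> x_gt0; apply: leq_ltn_trans (ltn_trans (ltnSn n) (ltn_expl _ (ltnSn 1))).
by apply: leq_trans (mul_mult_leq l x); rewrite leq_pmull.
Qed.

Lemma intpart_ext l l' :
  (forall x, 0 < x <= n -> count_mem x l = count_mem x l') -> l = l'.
Proof.
move=> eq_c; apply: val_inj; apply: (@sorted_eq _ geq).
- by move=> y x z le_yx le_zy; apply: leq_trans le_zy le_yx.
- by move=> x y; rewrite /geq /= -eqn_leq => /eqP.
- by have /and3P[] := partsP l.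
- by have /and3P[] := partsP l'.
apply/allP => x _ /=; apply/eqP.
have [->|x_gt0] := posnP x; first by rewrite !mult0.
have [le_x|lt_x] := leqP x n; first by rewrite eq_c ?x_gt0.
by rewrite !mult_gt_n.
Qed.

Definition mult_seq (f : nat -> nat) : seq nat :=
  sort geq (flatten [seq nseq (f x) x | x <- iota 1 n]).

Lemma mem_mult_seq f x : x \in mult_seq f -> 0 < x <= n.
Proof.
rewrite mem_sort => /flatten_mapP[y]; rewrite mem_iota add1n ltnS => y_n.
by rewrite mem_nseq => /andP[_ /eqP->].
Qed.

Lemma count_mult_seq f x : 0 < x <= n -> count_mem x (mult_seq f) = f x.
Proof.
move=> x_n; rewrite count_sort.
have: uniq (iota 1 n) := iota_uniq 1 n.
have: x \in iota 1 n by rewrite mem_iota add1n ltnS.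
elim: (iota 1 n) => //= y r IHr.
rewrite inE count_cat count_nseq /= => /predU1P[<-|r_x] /andP[r_y uniq_r].
  rewrite eqxx mul1n (count_memPn _) ?addn0 //; apply: contra r_y.
  by case/flatten_mapP => z r_z; rewrite mem_nseq => /andP[_ /eqP->].
by rewrite IHr //; case: eqP r_y => [->|]; rewrite ?r_x.
Qed.

Lemma mult_seq_partition (f : nat -> nat) :
  \sum_(x < n.+1) x * f x = n -> is_partition n (mult_seq f).
Proof.
move=> sum_f; apply/and3P; split.
- by apply: sort_sorted => x y; apply: leq_total.
- by apply/negP => /mem_mult_seq.
rewrite (@sumn_count n) => [|x /mem_mult_seq/andP[]//].
rewrite -[X in _ == X]sum_f; apply/eqP/eq_bigr => x _.
have [->//|x_gt0] := posnP x.
by rewrite count_mult_seq // x_gt0 -ltnS ltn_ord.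
Qed.

(** The first clause lets [count_of_mult] hold at every [x], also outside the range that [mult_seq]
    reads. *)
Definition mult_fun (f : nat -> nat) : Prop :=
  (forall x, ~~ (0 < x <= n) -> f x = 0) /\ \sum_(x < n.+1) x * f x = n.

Lemma mult_fun_count l : mult_fun (fun x => count_mem x l).
Proof.
split=> [x|]; last exact: sum_mult.
by rewrite negb_and -eqn0Ngt -ltnNge => /orP[/eqP->|/mult_gt_n//]; apply: mult0.
Qed.

(** Meant for trading copies of an odd part [m] against copies of an even part [e], which leaves all
    other multiplicities alone. *)
Lemma mult_fun_update f m e a b : mult_fun f -> m != e ->
  0 < m <= n -> 0 < e <= n -> m * a + e * b = m * f m + e * f e ->
  mult_fun [eta f with m |-> a, e |-> b].
Proof.
move=> [f0 sum_f] ne_me m_n e_n eq_ab; split=> [x x_n|] /=.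
  have [eq_x|_] := eqVneq x m; first by rewrite eq_x m_n in x_n.
  have [eq_x|_] := eqVneq x e; first by rewrite eq_x e_n in x_n.
  exact: f0.
have [lt_m lt_e]: m < n.+1 /\ e < n.+1 by case/andP: m_n; case/andP: e_n.
rewrite -[RHS]sum_f (bigD1 (Ordinal lt_m)) //= (bigD1 (Ordinal lt_e)) /=; last first.
  by rewrite -val_eqE /= eq_sym.
rewrite [RHS](bigD1 (Ordinal lt_m)) //= [X in _ = _ + X](bigD1 (Ordinal lt_e)) /=; last first.
  by rewrite -val_eqE /= eq_sym.
rewrite !eqxx [e == m]eq_sym (negPf ne_me) !addnA eq_ab; congr (_ + _).
apply: eq_bigr => x; rewrite -!val_eqE /= => /andP[ne_xm ne_xe].
by rewrite (negPf ne_xm) (negPf ne_xe).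
Qed.

(* The partition [l0] is a junk value, returned when [f] is not the multiplicity
   function of a partition of [n]. *)
Definition of_mult l0 (f : nat -> nat) : intpart n := insubd l0 (mult_seq f).

Lemma count_of_mult l0 f x : mult_fun f -> count_mem x (of_mult l0 f) = f x.
Proof.
case=> f0 /mult_seq_partition f_n.
have [x_n|x_n] := boolP (0 < x <= n).
  by rewrite -[parts _]/(val _) insubdK // count_mult_seq.
by rewrite f0 //; case: (mult_fun_count (of_mult l0 f)) => ->.
Qed.

Lemma all_oddP l : reflect (forall x, ~~ odd x -> count_mem x l = 0) (all odd l).
Proof.
apply: (iffP allP) => [l_odd x x_even|l_odd x l_x].
  by apply/count_memPn; apply: contra x_even => /l_odd.
by apply: contraLR l_x => /l_odd/count_memPn.
Qed.

(** * Glaisher's bijection *)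

(** Glaisher's map on multiplicities. The bound on [k] loses nothing: for odd [x] and [k > n], the
    number [2 ^ k * x] exceeds [n] and is not a part. *)
Definition merge l x :=
  if odd x then \sum_(k < n.+1) 2 ^ k * count_mem (2 ^ k * x) l else 0.

(** Inverse of Glaisher's map: if [x = 2 ^ k * m] with [m] odd, then [x] gets as multiplicity the
    [k]-th binary digit of the multiplicity of [m]. *)
Definition split l x : nat :=
  odd (count_mem (x %/ 2 ^ logn 2 x) l %/ 2 ^ logn 2 x).

Lemma split_pow2_mul l k m : odd m ->
  split l (2 ^ k * m) = odd (count_mem m l %/ 2 ^ k).
Proof. by move=> m_odd; rewrite /split logn2_pow2_mul // mulKn ?expn_gt0. Qed.

(** An odd quotient is positive, so [l] contains at least [2 ^ k] copies of [m]. *)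
Lemma odd_digit_leq l k m : odd (count_mem m l %/ 2 ^ k) -> 2 ^ k * m <= n.
Proof.
move=> odd_q; apply: leq_trans (mul_mult_leq l m).
by rewrite mulnC leq_mul2l -divn_gt0 ?expn_gt0 // odd_gt0 // orbT.
Qed.

Lemma mult_fun_merge l : mult_fun (merge l).
Proof.
split=> [x|].
  rewrite /merge negb_and -eqn0Ngt -ltnNge => /orP[/eqP->//|lt_x].
  case: ifP => // _; rewrite big1 // => k _; rewrite mult_gt_n ?muln0 //.
  by apply: leq_trans lt_x _; rewrite leq_pmull ?expn_gt0.
rewrite -[RHS](sum_mult l) (@dyadic_sum n (fun x => x * count_mem x l)) //; last first.
  by move=> x /mult_gt_n->; rewrite muln0.
rewrite [RHS]big_mkcond; apply: eq_bigr => m _; rewrite /merge.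
case: ifP => _; last by rewrite muln0.
by rewrite big_distrr; apply: eq_bigr => k _ /=; rewrite mulnCA mulnA.
Qed.

Lemma mult_fun_split l : all odd l -> mult_fun (split l).
Proof.
move=> /all_oddP l_odd; have split0 x : ~~ (0 < x <= n) -> split l x = 0.
  have [->|x_gt0] := posnP x; first by rewrite /split div0n mult0 div0n.
  have [k [m [m_odd ->]]] := odd_mul_pow2P x_gt0.
  rewrite split_pow2_mul // => /= nle_n; apply/eqP; rewrite eqb0.
  by apply: contra nle_n => /odd_digit_leq.
split=> //; rewrite (@dyadic_sum n (fun x => x * split l x)) // => [|x lt_x].
  rewrite -[RHS](sum_mult l) big_mkcond; apply: eq_bigr => m _.
  case: ifPn => [m_odd|/l_odd->]; last by rewrite muln0.
  rewrite -[in RHS](binary_sum (mult_lt l (odd_gt0 m_odd))) big_distrr.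
  by apply: eq_bigr => k _ /=; rewrite split_pow2_mul // mulnCA mulnA.
by rewrite split0 ?muln0 //; apply/negP => /andP[_]; rewrite leqNgt lt_x.
Qed.

(** Distinct parts have multiplicities 0 or 1, so [merge l] at an odd [m] is a binary expansion
    whose digits [binary_digit] reads back. *)
Lemma mergeK l : uniq l ->
  all odd (of_mult l (merge l)) /\
  of_mult (of_mult l (merge l)) (split (of_mult l (merge l))) = l.
Proof.
move=> l_uniq; set l' := of_mult l _.
have count_l' x : count_mem x l' = merge l x.
  by rewrite count_of_mult //; apply: mult_fun_merge.
have l'_odd: all odd l'.
  by apply/all_oddP => x x_even; rewrite count_l' /merge (negPf x_even).
split=> //; apply: intpart_ext => x /andP[x_gt0 le_x].
rewrite count_of_mult; last exact: mult_fun_split.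
have [k [m [m_odd def_x]]] := odd_mul_pow2P x_gt0.
have lt_k: k < n.+1.
  apply: leq_trans (ltn_expl k (ltnSn 1)) (leqW (leq_trans _ le_x)).
  by rewrite def_x leq_pmulr ?odd_gt0.
rewrite def_x split_pow2_mul // count_l' /merge m_odd.
under eq_bigr do rewrite count_uniq_mem //.
by rewrite (@binary_digit _ (fun k => 2 ^ k * m \in parts l)) // count_uniq_mem.
Qed.

(** The values of [split l] are single bits, whence distinct parts; [binary_sum] reassembles each
    multiplicity from its digits. *)
Lemma splitK l : all odd l ->
  uniq (of_mult l (split l)) /\
  of_mult (of_mult l (split l)) (merge (of_mult l (split l))) = l.
Proof.
move=> l_odd; set l' := of_mult l _.
have count_l' x : count_mem x l' = split l x.
  by rewrite count_of_mult //; apply: mult_fun_split.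
split; first apply: count_mem_uniq => x.
  rewrite -has_pred1 has_count count_l' /split; by case: odd.
apply: intpart_ext => x /andP[x_gt0 _].
rewrite count_of_mult; last exact: mult_fun_merge.
rewrite /merge; case: ifPn => [x_odd|]; last by move/(all_oddP _ l_odd).
under eq_bigr do rewrite count_l' split_pow2_mul //.
by rewrite binary_sum ?mult_lt.
Qed.

Lemma sum_size_uniq :
  \sum_(l : intpart n | uniq l) size l
  = \sum_(l : intpart n | all odd l) \sum_(m < n.+1 | odd m) \sum_(k < n.+1)
      odd (count_mem (m : nat) l %/ 2 ^ k).
Proof.
pose h' l := of_mult l (merge l).
rewrite (@big_bij _ _ _ _ _ (fun l => of_mult l (split l)) h' _ (fun l => all odd l)).
- apply: eq_bigr => l l_odd; have [uniq_l' _] := splitK l_odd.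
  (* Distinctness turns the number of parts into the number of values that occur, which [dyadic_sum]
     then groups by odd factor. *)
  rewrite -(undup_id uniq_l') (@size_undup_sum n) => [|x]; last exact: mem_intpart_leq.
  rewrite (@dyadic_sum n (fun x => nat_of_bool (x \in parts (of_mult l (split l))))).
  + apply: eq_bigr => m m_odd; apply: eq_bigr => k _.
    rewrite -count_uniq_mem // count_of_mult; last exact: mult_fun_split.
    exact: split_pow2_mul.
  + by rewrite -count_uniq_mem // mult0.
  + by move=> x lt_x; rewrite -count_uniq_mem // mult_gt_n.
- exact: mergeK.
- exact: splitK.
Qed.

Lemma sum_size_odd :
  \sum_(l : intpart n | all odd l) size (undup l)
  = \sum_(l : intpart n | all odd l) \sum_(m < n.+1 | odd m)
      (0 < count_mem (m : nat) l).
Proof.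
apply: eq_bigr => l l_odd.
rewrite (@size_undup_sum n) => [|x]; last exact: mem_intpart_leq.
rewrite [RHS]big_mkcond; apply: eq_bigr => m _.
rewrite -has_count has_pred1; case: ifPn => // m_even; apply/eqP; rewrite eqb0.
by apply: contra m_even => /(allP l_odd).
Qed.

(** * Partitions with a single even part size *)

(** Phrases every condition through multiplicities, which are what [count_of_mult] gives for a
    partition built by [of_mult]. *)
Lemma single_even_condP (s : seq nat) k m :
  reflect [/\ 0 < k, odd m, forall x, ~~ odd x -> x != 2 ^ k * m -> count_mem x s = 0,
             odd (count_mem (2 ^ k * m) s) & 0 < count_mem m s < 2 ^ k]
          (single_even_cond s k m).
Proof.
have ltE c : (1 <= c <= 2 ^ k - 1) = (0 < c < 2 ^ k).
  by rewrite leq_subRL ?expn_gt0 // add1n.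
apply: (iffP and5P); rewrite ltE => -[k_gt0 m_odd even_s e_odd m_s]; split=> //.
  move=> x x_even ne_x; apply/count_memPn; apply: contra ne_x => s_x.
  by rewrite -mem_seq1 -(eqP even_s) mem_undup mem_filter x_even.
apply/eqP; apply: perm_small_eq => //; apply: uniq_perm; rewrite ?undup_uniq //.
move=> x; rewrite mem_undup mem_filter mem_seq1; have [->|ne_x] := eqVneq x.
  by rewrite oddM oddX gtn_eqF //= -has_pred1 has_count odd_gt0.
apply/negP => /andP[x_even]; apply/negP; apply/count_memPn; exact: even_s.
Qed.

(** The sole even part value determines [(k, m)], so at most one pair qualifies and the existential
    equals a count. As a sum, it can be exchanged with the sum over partitions. *)
Lemma single_even_sum l :
  single_even l
  = \sum_(m < n.+1 | odd m) \sum_(k < n.+1) single_even_cond l k m :> nat.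
Proof.
rewrite /single_even; case: existsP => [[k /existsP[m lkm]]|no_km]; last first.
  rewrite big1 // => m _; rewrite big1 // => k _; apply/eqP; rewrite eqb0.
  by apply/negP => lkm; case: no_km; exists k; apply/existsP; exists m.
have [k_gt0 m_odd even_l _ _] := single_even_condP _ _ _ lkm.
have km_uniq (k' m' : 'I_n.+1) : single_even_cond l k' m' -> k' = k /\ m' = m.
  case/single_even_condP => k'_gt0 m'_odd _ e_odd _.
  (* Otherwise the even number [2 ^ k' * m'] would have multiplicity 0 in [l], which is not odd. *)
  have: 2 ^ k' * m' == 2 ^ k * m.
    apply: contraLR e_odd => /even_l-> //.
    by rewrite oddM oddX gtn_eqF.
  by case/eqP/(odd_mul_pow2_inj m'_odd m_odd) => /val_inj-> /val_inj->.
rewrite (bigD1 m) //= (bigD1 k) //= lkm !big1 ?addn0 // => [m' /andP[_]|k'].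
  apply: contraNeq; rewrite sum_nat_eq0 => /forallPn[k'].
  by rewrite /= eqb0 negbK => /km_uniq[_ ->].
by apply: contraNeq; rewrite eqb0 negbK => /km_uniq[->].
Qed.

(** Replacing each copy of [2 ^ k * m] by [2 ^ k] copies of [m] is undone by Euclidean division by
    [2 ^ k]: the original multiplicity of [m] is below [2 ^ k], so it is the remainder, and that of
    the even part is the quotient. *)
Lemma sum_single_even_cond k m : odd m ->
  \sum_(l : intpart n) single_even_cond l k m
  = \sum_(l : intpart n | all odd l)
      (odd (count_mem m l %/ 2 ^ k) && (0 < count_mem m l %% 2 ^ k)).
Proof.
move=> m_odd; have [->|k_gt0] := posnP k.
  (* For [k = 0] both sides vanish: the condition demands [k >= 1], and a remainder modulo 1 is
     never positive. *)
  by rewrite !big1 // => l _; rewrite modn1 andbF.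
set e := 2 ^ k * m.
have e_even: ~~ odd e by rewrite oddM oddX gtn_eqF.
have ne_me: m != e by apply: contraTneq m_odd => ->.
have m_gt0 := odd_gt0 m_odd.
have e_gt0: 0 < e by rewrite muln_gt0 expn_gt0.
have le_me: m <= e by rewrite leq_pmull ?expn_gt0.
pose f (l : intpart n) := let c x := count_mem x l in
  [eta c with m |-> c m + 2 ^ k * c e, e |-> 0].
pose g (l : intpart n) := let c x := count_mem x l in
  [eta c with m |-> c m %% 2 ^ k, e |-> c m %/ 2 ^ k].
(* The bound [e <= n] keeps the updated place within range. It holds on one side because [e] is a
   part, on the other by [odd_digit_leq]. *)
have f_mult l : e <= n -> mult_fun (f l).
  move=> le_n; apply: mult_fun_update => //; first exact: mult_fun_count.
  - by rewrite m_gt0 (leq_trans le_me).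
  - by rewrite e_gt0.
  - by rewrite muln0 addn0 mulnDr mulnA [m * 2 ^ k]mulnC.
have g_mult l : all odd l -> e <= n -> mult_fun (g l).
  move=> /all_oddP l_odd le_n; apply: mult_fun_update => //; first exact: mult_fun_count.
  - by rewrite m_gt0 (leq_trans le_me).
  - by rewrite e_gt0.
  - rewrite (l_odd e) // muln0 addn0 [in RHS](divn_eq (count_mem m l) (2 ^ k)).
    by rewrite mulnDr addnC /e; congr (_ + _); rewrite mulnAC mulnC [2 ^ k * _]mulnC.
pose Q l := all odd l && (odd (count_mem m l %/ 2 ^ k) && (0 < count_mem m l %% 2 ^ k)).
transitivity (\sum_(l : intpart n | single_even_cond l k m) 1).
  by rewrite [RHS]big_mkcond; apply: eq_bigr => l _; case: single_even_cond.
transitivity (\sum_(l : intpart n | Q l) 1); last first.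
  by rewrite [LHS]big_mkcondr; apply: eq_bigr => l _; case: (_ && _).
apply: (@big_bij _ _ _ _ _ (fun l => of_mult l (g l)) (fun l => of_mult l (f l))).
- move=> l /single_even_condP[_ _ even_l e_odd /andP[m_l lt_m]].
  have le_n: e <= n.
    by apply: (@mem_intpart_leq _ l); rewrite -has_pred1 has_count odd_gt0.
  set l' := of_mult l (f l).
  have count_l' x : count_mem x l' = f l x by apply/count_of_mult/f_mult.
  have l'_odd: all odd l'.
    apply/all_oddP => x x_even; rewrite count_l' /=.
    have [eq_x|_] := eqVneq x m; first by rewrite eq_x m_odd in x_even.
    by have [//|ne_x] := eqVneq x e; apply: even_l.
  have l'_m: count_mem m l' = count_mem m l + 2 ^ k * count_mem e l.
    by rewrite count_l' /= eqxx.
  have l'_div: count_mem m l' %/ 2 ^ k = count_mem e l.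
    by rewrite l'_m addnC mulnC divnMDl ?expn_gt0 // divn_small ?addn0.
  have l'_mod: count_mem m l' %% 2 ^ k = count_mem m l.
    by rewrite l'_m addnC mulnC modnMDl modn_small.
  split; first by rewrite /Q l'_odd l'_div l'_mod e_odd.
  apply: intpart_ext => x _; rewrite count_of_mult; last exact: g_mult.
  rewrite /= l'_div l'_mod; have [->//|ne_xm] := eqVneq x m.
  have [->//|ne_xe] := eqVneq x e.
  by rewrite count_l' /= (negPf ne_xm) (negPf ne_xe).
- move=> l /and3P[l_odd odd_q mod_gt0].
  have le_n: e <= n := odd_digit_leq odd_q.
  set l' := of_mult l (g l).
  have count_l' x : count_mem x l' = g l x by apply/count_of_mult/g_mult.
  have l'_m: count_mem m l' = count_mem m l %% 2 ^ k by rewrite count_l' /= eqxx.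
  have l'_e: count_mem e l' = count_mem m l %/ 2 ^ k.
    by rewrite count_l' /= eq_sym (negPf ne_me) eqxx.
  split.
    apply/single_even_condP; split=> // [x x_even ne_x||].
    + rewrite count_l' /= (negPf ne_x); case: eqP => [eq_x|_].
        by rewrite eq_x m_odd in x_even.
      exact: (all_oddP _ l_odd).
    + by rewrite l'_e.
    + by rewrite l'_m mod_gt0 ltn_mod expn_gt0.
  apply: intpart_ext => x _; rewrite count_of_mult; last exact: f_mult.
  rewrite /= l'_m l'_e addnC mulnC -divn_eq; have [->//|ne_xm] := eqVneq x m.
  have [->|ne_xe] := eqVneq x e; first by rewrite (all_oddP _ l_odd).
  by rewrite count_l' /= (negPf ne_xm) (negPf ne_xe).
Qed.

(** With the sum over partitions innermost, [m] and [k] are fixed and [sum_single_even_cond] applies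
    to each pair. *)
Lemma a1_sum :
  a1 n = \sum_(l : intpart n | all odd l) \sum_(m < n.+1 | odd m) \sum_(k < n.+1)
      (odd (count_mem (m : nat) l %/ 2 ^ k) && (0 < count_mem (m : nat) l %% 2 ^ k)).
Proof.
rewrite /a1 -sum1dep_card big_mkcond /=.
under eq_bigr => l _ do rewrite -[if _ then _ else _]/(nat_of_bool _) single_even_sum.
rewrite exchange_big [RHS]exchange_big; apply: eq_bigr => m m_odd /=.
rewrite exchange_big [RHS]exchange_big; apply: eq_bigr => k _ /=.
exact: sum_single_even_cond.
Qed.

End Multiplicities.

Theorem theorem3 (n : nat) (n_ge1 : 1 <= n) : (a1 n)%:Z%R = b1 n.
Proof.
rewrite /b1; apply/esym/eqP; rewrite GRing.subr_eq -PoszD eqz_nat; apply/eqP.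
rewrite sum_size_uniq sum_size_odd a1_sum -big_split; apply: eq_bigr => l _ /=.
rewrite -big_split; apply: eq_bigr => m m_odd /=.
(* For each [l] and odd [m], the lowest digit 1 of the multiplicity accounts for [m] as a different
   part, and the other digits 1 account for [a1 n]. *)
by rewrite -digits_split // mult_lt ?odd_gt0.
Qed.
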